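(* Let $d=1$ and let $f:\mathbb{R}\to\mathbb{R}$ be a given continuous function with at most cubic growth at $\pm\infty$. Let $g(x,\sigma)=f(x)\sigma$ for $(x,\sigma)\in\mathbb{R}\times\mathbb{R}$, let $\sigma_T:\mathscr{P}_3(\mathbb{R})\to\mathbb{R}$, $\sigma_T(m)=\int_{\mathbb{R}}f\,dm$, and let $G:\mathbb{R}\times\mathscr{P}_3(\mathbb{R})\to\mathbb{R}$, $G(x,m)=g(x,\sigma_T(m))$. (1) $G$ is always Lasry–Lions monotone, regardless of the choice of $f$. (2) Let $f(x)=\frac13x^3$. Then $G$ satisfies none of the conditions $(\mathrm{L}^2)$, $-(\mathrm{L}^2)$, $(\sigma)$, $-(\sigma)$.
   Context: $\mathscr{P}_3(\mathbb{R})$: Borel probability measures on $\mathbb{R}$ with finite third absolute moment. $(\Omega,\mathcal{A},\mathbb{P})$ is an atomless probability space, $\mathcal{L}_X$ the law of a random variable $X$ on it. Random variables below are such that all quantities are defined (here: in $L^3(\Omega;\mathbb{R})$). Lasry–Lions monotonicity: $\int_{\mathbb{R}}(G(x,m_1)-G(x,m_2))\,d(m_1-m_2)(x)\ge0$ for all $m_1,m_2\in\mathscr{P}_3(\mathbb{R})$. The Lagrangian is $L(x,v)=\frac12|v|^2$, and optimality of endpoints is expressed by the first-order condition $y+T\,D_xG(y,m)=x$. For an initial random variable $X_0$ and $T>0$, regarding $(I+T\,D_xG(\cdot,m))^{-1}(x)=\{y:y+T\,D_xG(y,m)=x\}$ as a multi-valued map, put $$\tilde E_T(X)=\{Y:\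 Y\in(I+T\,D_xG(\cdot,\mathcal{L}_X))^{-1}(X_0)\ \text{a.s.}\},$$ $$\Omega(\sigma)=\{\sigma_T(\mathcal{L}_Y):\ Y\in(I+T\,D_xg(\cdot,\sigma))^{-1}(X_0)\ \text{a.s.}\}.$$ Condition $(\mathrm{L}^2)$: for all initial random variables $X_0$ and all $T>0$, $\mathbb{E}[(Y_1-Y_2)(X_1-X_2)]\le\mathbb{E}|X_1-X_2|^2$ for all $X_1,X_2$ and all $Y_1\in\tilde E_T(X_1)$, $Y_2\in\tilde E_T(X_2)$. Condition $(\sigma)$: for all initial random variables $X_0$ and all $T>0$, $(\tau_1-\tau_2)(\sigma_1-\sigma_2)\le|\sigma_1-\sigma_2|^2$ for all $\sigma_1,\sigma_2\in\mathrm{range}\,\sigma_T$ and all $\tau_1\in\Omega(\sigma_1)$, $\tau_2\in\Omega(\sigma_2)$. Conditions $-(\mathrm{L}^2)$ and $-(\sigma)$ are the same with the inequality sign reversed ($\ge$ in place of $\le$). *)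

(* Defs.v *)
From HB Require Import structures.
From mathcomp Require Import all_boot all_order all_algebra.
From mathcomp Require Import all_classical all_reals all_analysis.
From mathcomp Require Import measurable_realfun.

Set Implicit Arguments.
Unset Strict Implicit.
Unset Printing Implicit Defensive.
Import Order.TTheory GRing.Theory Num.Theory.
Import numFieldNormedType.Exports.

Local Open Scope classical_set_scope.
Local Open Scope ring_scope.

Definition atomless d (T : measurableType d) (R : realType)
    (P : probability T R) : Prop :=
  forall A, measurable A -> (0 < P A)%E ->
    exists B, [/\ measurable B, B `<=` A, (0 < P B)%E & (P B < P A)%E].

Record P3 (R : realType) := MkP3 {
  P3_prob :> probability R R ;
  P3_moment : (\int[P3_prob]_x (`|x| ^+ 3)%:E < +oo)%E }.

Lemma le1_3 (R : realType) : (1 <= 3%:E :> \bar R)%E.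
Proof. by rewrite lee_fin ler1n. Qed.

Notation L3 P := (LfunType P (le1_3 _)).

Section law.
Context d (T : measurableType d) (R : realType) (P : probability T R).
Implicit Type X : L3 P.

Lemma law_moment X :
  (\int[distribution P X]_x (`|x| ^+ 3)%:E < +oo)%E.
Proof.
have mf : measurable_fun [set: R] (fun x : R => (`|x| ^+ 3)%:E).
  by apply/measurable_EFinP; apply: measurable_funX; exact: normr_measurable.
have f0 (x : R) : (0 <= (`|x| ^+ 3)%:E)%E by rewrite lee_fin exprn_ge0.
rewrite (ge0_integral_distribution X mf f0).
have /Lfun_integrable : (X : T -> R) \in Lfun P 3%:E by exact: LfunP.
rewrite ler1n => /(_ isT) /integrableP[_]; apply: le_lt_trans.
apply: ge0_le_integral => //=.
- by apply: (measurableT_comp mf); exact: measurable_funPT.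
- apply/measurable_EFinP; apply: measurableT_comp => //.
  apply: (measurableT_comp (measurable_powR _)) => //.
  by apply: measurableT_comp => //; exact: measurable_funPT.
- by move=> x _; rewrite lee_fin powR_mulrn// ler_norm.
Qed.

Definition law X : P3 R :=
  @MkP3 R (distribution P X) (law_moment X).

End law.

Section meanfield.
Context (R : realType).
Implicit Types (f : R -> R) (g : R -> R -> R) (s : P3 R -> R)
  (G : R -> P3 R -> R) (m : P3 R) (t : R).

Definition cubic_growth f : Prop :=
  exists C : R, (\forall x \near +oo, `|f x| <= C * `|x| ^+ 3) /\
                (\forall x \near -oo, `|f x| <= C * `|x| ^+ 3).

Definition sigma_T f m : R := \int[m]_x f x.

Definition g_of f (x sigma : R) : R := f x * sigma.

Definition G_of f (x : R) m : R := g_of f x (sigma_T f m).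

(* The integral of [h] against the signed measure [m1 - m2] is
   [\int h dm1 - \int h dm2]. *)
Definition Lasry_Lions_monotone G : Prop :=
  forall m1 m2 : P3 R,
    let h x := (G x m1 - G x m2)%:E in
    (0 <= \int[m1]_x h x - \int[m2]_x h x)%E.

(* [(I + t D u)^-1 (x)], as a multi-valued map. *)
Definition resolvent t (u : R -> R) (x : R) : set R :=
  [set y | y + t * (u^`()%classic y) = x].

Section conditions.
Context d (Omega : measurableType d) (P : probability Omega R).
Implicit Types X Y : L3 P.

Definition Etilde G t X0 X : set (L3 P) :=
  [set Y : L3 P |
    {ae P, forall w, resolvent t (G^~ (law X)) (X0 w) (Y w)}].

Definition Omega_map g s t X0 (sigma : R) : set R :=
  [set s (law Y) | Y in
    [set Y : L3 P | {ae P, forall w, resolvent t (g^~ sigma) (X0 w) (Y w)}]].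

Definition cond_L2 G : Prop :=
  forall X0 t, 0 < t -> forall X1 X2 Y1 Y2,
    Etilde G t X0 X1 Y1 -> Etilde G t X0 X2 Y2 ->
    ('E_P[fun w => ((Y1 w - Y2 w) * (X1 w - X2 w))%R]
      <= 'E_P[fun w => (`|X1 w - X2 w| ^+ 2)%R])%E.

Definition cond_neg_L2 G : Prop :=
  forall X0 t, 0 < t -> forall X1 X2 Y1 Y2,
    Etilde G t X0 X1 Y1 -> Etilde G t X0 X2 Y2 ->
    ('E_P[fun w => (`|X1 w - X2 w| ^+ 2)%R]
      <= 'E_P[fun w => ((Y1 w - Y2 w) * (X1 w - X2 w))%R])%E.

Definition cond_sigma g s : Prop :=
  forall X0 t, 0 < t -> forall sigma1 sigma2 tau1 tau2,
    range s sigma1 -> range s sigma2 ->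
    Omega_map g s t X0 sigma1 tau1 -> Omega_map g s t X0 sigma2 tau2 ->
    (tau1 - tau2) * (sigma1 - sigma2) <= `|sigma1 - sigma2| ^+ 2.

Definition cond_neg_sigma g s : Prop :=
  forall X0 t, 0 < t -> forall sigma1 sigma2 tau1 tau2,
    range s sigma1 -> range s sigma2 ->
    Omega_map g s t X0 sigma1 tau1 -> Omega_map g s t X0 sigma2 tau2 ->
    `|sigma1 - sigma2| ^+ 2 <= (tau1 - tau2) * (sigma1 - sigma2).

End conditions.
End meanfield.

(* Main.v *)
Require Import Defs.
From mathcomp Require Import all_boot all_order all_algebra.
From mathcomp Require Import all_classical all_reals all_analysis.
From mathcomp Require Import measurable_realfun lra.
Import Order.TTheory GRing.Theory Num.Theory.
Import numFieldNormedType.Exports.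
Local Open Scope classical_set_scope.
Local Open Scope ring_scope.

(** Writing [s i] for the integral of [f] against [m_i], the difference
    [G x m1 - G x m2] is [f x * (s 1 - s 2)], so integrating it against
    [m1 - m2] gives the square [(s 1 - s 2) ^+ 2], which is nonnegative.  The
    only analytic point is that [f] is integrable against measures with a
    finite third moment ([P3_integrable]): this makes the two integrals finite
    and linear.

    For [f x = x ^+ 3 / 3] the optimality condition with [T = 1] and initial
    datum [0] reads [y + sigma * y ^+ 2 = 0]; it has the two solutions [0] and
    [- sigma^-1] when [sigma] is nonzero.  The freedom to select
    either one refutes all four conditions, and constant random variables
    suffice.  Take [X1 = 1] and
    [X2 = 2], hence [sigma1 = 1 / 3] and [sigma2 = 8 / 3].
    - Selecting [Y1 = -3] and [Y2 = 0], the solution jumps in the same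
      direction as [X] by more than [X] does: the products to be compared are
      [3 > 1] for the random variables and [21 > 49 / 9] for the values of
      [sigma_T].  This excludes the two upper bounds.
    - Selecting [Y1 = Y2 = 0], the left product vanishes while
      [X1 - X2] and [sigma1 - sigma2] do not, which excludes the two reversed
      bounds. *)

(** * Lasry-Lions monotonicity *)

(** Growth at infinity controls [f] outside a compact interval, and continuity
    controls it inside. *)
Lemma continuous_cubic_growth_bound (R : realType) (f : R -> R) :
  continuous f -> cubic_growth f ->
  exists M : R, forall x, `|f x| <= M + M * `|x| ^+ 3.
Proof.
move=> cf [C [[a [_ fa]] [b [_ fb]]]].
(* The minimum keeps the interval nonempty: nothing orders the thresholds at
   minus and plus infinity. *)
have cnf : {within `[Num.min b a, a], continuous (fun x => `|f x|)}.
  apply: continuous_subspaceT => x.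
  by apply: continuous_comp; [exact: cf|exact: norm_continuous].
have [|c _ fc] := EVT_max _ cnf; first by rewrite ge_min lexx orbT.
have nx3 (z : R) : 0 <= `|z| ^+ 3 by rewrite exprn_ge0.
(* The absolute value of [C] spares deriving [0 <= C] from the growth bound. *)
exists (`|f c| + `|C|) => x.
have := nx3 x; set y := _ ^+ 3 => y0.
have yf : 0 <= `|f c| * y by rewrite mulr_ge0.
have yC : 0 <= `|C| * y by rewrite mulr_ge0.
have CC : C * y <= `|C| * y by rewrite ler_wpM2r// ler_norm.
have := normr_ge0 (f c); have := normr_ge0 C.
have [xa|ax] := ltP a x; first by have := fa x xa; rewrite -/y; lra.
have [xb|bx] := ltP x (Num.min b a).
  have {}xb : x < b by rewrite (lt_le_trans xb)// ge_min lexx.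
  by have := fb x xb; rewrite -/y; lra.
have := fc x; rewrite in_itv/= bx ax => /(_ isT).
lra.
Qed.

Lemma P3_integrable (R : realType) (m : P3 R) (f : R -> R) :
  continuous f -> cubic_growth f -> m.-integrable setT (EFin \o f).
Proof.
move=> cf /(continuous_cubic_growth_bound _ _ cf)[M fM].
have i3 : m.-integrable setT (fun x => (`|x| ^+ 3)%:E).
  apply/integrableP; split.
    by apply/measurable_EFinP; apply: measurable_funX; exact: normr_measurable.
  under eq_integral do rewrite gee0_abs ?lee_fin ?exprn_ge0//.
  exact: P3_moment.
apply: (@le_integrable _ _ _ m _ measurableT _ (fun x => M%:E + M%:E * (`|x| ^+ 3)%:E)%E).
- by apply/measurable_EFinP; exact: continuous_measurable_fun.
- move=> x _ /=; rewrite lee_fin.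
  by rewrite (le_trans (fM x))// ler_norm.
- apply: integrableD => //; first exact: finite_measure_integrable_cst.
  exact: integrableZl.
Qed.

Lemma G_of_Lasry_Lions (R : realType) (f : R -> R) :
  continuous f -> cubic_growth f -> Lasry_Lions_monotone (G_of f).
Proof.
move=> cf gf m1 m2 /=.
pose s (m : P3 R) := sigma_T f m.
(* The integrals against [m1] and [m2] separately are finite, so the difference
   below is a genuine one and not one of infinities. *)
have intE (m : P3 R) : (\int[m]_x (G_of f x m1 - G_of f x m2)%:E =
    ((s m1 - s m2) * s m)%:E)%E.
  under eq_integral do rewrite -mulrBr mulrC EFinM.
  have fi := P3_integrable _ m f cf gf.
  by rewrite integralZl// EFinM /s /sigma_T /Rintegral fineK// integrable_fin_num.
by rewrite !intE -EFinB lee_fin -mulrBr -expr2 sqr_ge0.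
Qed.

(** * Constant random variables *)

Section constant_variables.
Context d (T : measurableType d) (R : realType) (P : probability T R).

Definition cstL3 (c : R) : L3 P := Lfun_Sub (le1_3 R) (Lfun_cst P c 3).

Lemma sigma_T_law_cst (f : R -> R) c :
  measurable_fun setT f -> sigma_T f (law (cstL3 c)) = f c.
Proof.
move=> mf; rewrite /sigma_T /Rintegral.
have -> : (\int[law (cstL3 c)]_x (f x)%:E = (f c)%:E)%E.
  rewrite (@integral_distribution _ _ _ _ _ P (cstL3 c) (EFin \o f)).
  - rewrite (_ : _ \o _ = cst (f c)%:E) //.
    by rewrite integral_cst// [X in (_ * X)%E]probability_setT mule1.
  - exact/measurable_EFinP.
  - exact: (finite_measure_integrable_cst P (f c) measurableT).
by [].
Qed.

End constant_variables.

(** * Failure of the four conditions for the cubic coupling *)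

Definition third_cube (R : realType) (x : R) : R := 3^-1 * x ^+ 3.

Lemma measurable_third_cube (R : realType) :
  measurable_fun setT (@third_cube R).
Proof. by apply: measurable_funM => //; exact: exprn_measurable. Qed.

(** The derivative of [z ^+ 3 / 3 * s] is [s * z ^+ 2]: membership in the
    resolvent is a quadratic equation, which can have two solutions. *)
Lemma resolvent_third_cube (R : realType) (t s x y : R) :
  y + t * (s * y ^+ 2) = x -> resolvent t (fun z => third_cube R z * s) x y.
Proof.
rewrite /resolvent/= derive1E.
have df : is_derive y 1 (fun z : R => third_cube R z * s) (s * y ^+ 2).
  apply: is_derive_eq.
  rewrite /GRing.scale/=; lra.
by rewrite derive_val.
Qed.

Section constant_solutions.
Context d (T : measurableType d) (R : realType) (P : probability T R).
Local Notation f := (third_cube R).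
Local Notation k := (cstL3 _ _ _ P).

(** A constant [X] equal to [a] has [sigma_T] equal to [f a], so on constants
    the almost sure inclusion is the quadratic equation at [sigma = f a]. *)
Lemma Etilde_cst t c a y :
  y + t * (f a * y ^+ 2) = c -> Etilde (G_of f) t (k c) (k a) (k y).
Proof.
move=> yc; apply/aeW => w.
rewrite /G_of /g_of sigma_T_law_cst; last exact: measurable_third_cube.
exact: resolvent_third_cube.
Qed.

Lemma Omega_map_cst t c s y :
  y + t * (s * y ^+ 2) = c ->
  Omega_map (g_of f) (sigma_T f) t (k c) s (f y).
Proof.
move=> yc; exists (k y).
  by apply/aeW => w; exact: resolvent_third_cube.
by rewrite sigma_T_law_cst//; exact: measurable_third_cube.
Qed.

Lemma range_sigma_T_cst a : range (sigma_T f) (f a).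
Proof.
by exists (law (k a)) => //; rewrite sigma_T_law_cst//; exact: measurable_third_cube.
Qed.

(** At [X1 = 1] the nonzero solution is [- (f 1)^-1 = -3]; at [X2 = 2] the zero
    solution is selected. *)
Lemma not_cond_L2 : ~ cond_L2 P (G_of f).
Proof.
move=> /(_ (k 0) 1 ltr01 (k 1) (k 2) (k (- 3)) (k 0)).
have -> : (fun w => (k (-3) w - k 0 w) * (k 1 w - k 2 w)) = cst 3.
  by apply/funext => w /=; lra.
have -> : (fun w => `|k 1 w - k 2 w| ^+ 2) = cst 1.
  by apply/funext => w /=; rewrite real_normK ?num_real//; lra.
rewrite !expectation_cst lee_fin.
have H1 : Etilde (G_of f) 1 (k 0) (k 1) (k (- 3)).
  by apply: Etilde_cst; rewrite /third_cube; lra.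
have H2 : Etilde (G_of f) 1 (k 0) (k 2) (k 0).
  by apply: Etilde_cst; rewrite /third_cube; lra.
move=> /(_ H1 H2); lra.
Qed.

(** Zero solves the equation whatever [X] is, so [Y] need not move with [X]. *)
Lemma not_cond_neg_L2 : ~ cond_neg_L2 P (G_of f).
Proof.
move=> /(_ (k 0) 1 ltr01 (k 1) (k 2) (k 0) (k 0)).
have -> : (fun w => (k 0 w - k 0 w) * (k 1 w - k 2 w)) = cst 0.
  by apply/funext => w /=; lra.
have -> : (fun w => `|k 1 w - k 2 w| ^+ 2) = cst 1.
  by apply/funext => w /=; rewrite real_normK ?num_real//; lra.
rewrite !expectation_cst lee_fin.
have H a : Etilde (G_of f) 1 (k 0) (k a) (k 0).
  by apply: Etilde_cst; rewrite /third_cube; lra.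
move=> /(_ (H 1) (H 2)); lra.
Qed.

(** The same selection as for random variables; the solution [-3] is mapped to
    [f (- 3) = -9], while [f 2 - f 1] is only [7 / 3]. *)
Lemma not_cond_sigma : ~ cond_sigma P (g_of f) (sigma_T f).
Proof.
move=> /(_ (k 0) 1 ltr01 (f 1) (f 2) (f (- 3)) (f 0)).
move=> /(_ (range_sigma_T_cst _) (range_sigma_T_cst _)).
have H1 : Omega_map (g_of f) (sigma_T f) 1 (k 0) (f 1) (f (- 3)).
  by apply: Omega_map_cst; rewrite /third_cube; lra.
have H2 : Omega_map (g_of f) (sigma_T f) 1 (k 0) (f 2) (f 0).
  by apply: Omega_map_cst; rewrite /third_cube; lra.
move=> /(_ H1 H2); rewrite real_normK ?num_real// /third_cube; lra.
Qed.

Lemma not_cond_neg_sigma : ~ cond_neg_sigma P (g_of f) (sigma_T f).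
Proof.
move=> /(_ (k 0) 1 ltr01 (f 1) (f 2) (f 0) (f 0)).
move=> /(_ (range_sigma_T_cst _) (range_sigma_T_cst _)).
have H s : Omega_map (g_of f) (sigma_T f) 1 (k 0) s (f 0).
  by apply: Omega_map_cst; rewrite /third_cube; lra.
move=> /(_ (H _) (H _)); rewrite real_normK ?num_real// /third_cube; lra.
Qed.

End constant_solutions.

Theorem proposition4p2 (R : realType) (d : measure_display)
    (Omega : measurableType d) (P : probability Omega R) (hP : atomless P) :
  (forall f : R -> R, continuous f -> cubic_growth f ->
     Lasry_Lions_monotone (G_of f))
  /\
  (let f := fun x : R => 3^-1 * x ^+ 3 in
   [/\ ~ cond_L2 P (G_of f),
       ~ cond_neg_L2 P (G_of f),
       ~ cond_sigma P (g_of f) (sigma_T f) &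
       ~ cond_neg_sigma P (g_of f) (sigma_T f)]).
Proof.
split; first exact: G_of_Lasry_Lions.
split; [exact: not_cond_L2 | exact: not_cond_neg_L2 |
        exact: not_cond_sigma | exact: not_cond_neg_sigma].
Qed.
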